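(* Let $K\ge 1$ and $0\le L<U\le K$ be integers with $$(K-2L)(2U-K)\ge K.$$ Then an invariant design $\bar\xi$ on $\mathcal{X}$ is $D$-optimal on $\mathcal{X}$ if and only if $m_1(\bar\xi)=m_2(\bar\xi)=0$.
   Context: Let $K\ge 1$ and $0\le L<U\le K$ be integers. For $\bm{x}=(x_1,\dots,x_K)^\top\in\{-1,+1\}^K$ let $d(\bm{x})=(K+\sum_{j=1}^K x_j)/2$ be the number of entries equal to $+1$. The design region is $\mathcal{X}=\{\bm{x}\in\{-1,+1\}^K : L\le d(\bm{x})\le U\}$. The regression function is $\bm{f}(\bm{x})=(1,x_1,\dots,x_K)^\top\in\mathbb{R}^{K+1}$. A design $\xi$ on $\mathcal{X}$ is a probability weight function on the finite set $\mathcal{X}$ ($\xi(\bm{x})\ge 0$ real, $\sum_{\bm{x}\in\mathcal{X}}\xi(\bm{x})=1$). Its information matrix is $\mathbf{M}(\xi)=\sum_{\bm{x}\in\mathcal{X}}\xi(\bm{x})\bm{f}(\bm{x})\bm{f}(\bm{x})^\top$. A design $\xi^*$ on $\mathcal{X}$ is $D$-optimal if $\det\mathbf{M}(\xi^* )\ge\det\mathbf{M}(\xi)$ for all designs $\xi$ on $\mathcal{X}$. For $k\in\{L,\dots,U\}$ the orbit is $\mathcal{O}_k=\{\bm{x}\in\mathcal{X}: d(\bm{x})=k\}$, and $\bar\xi_k$ denotes the uniform design on $\mathcal{O}_k$, with weight $1/\binom{K}{k}$ at each point of $\mathcal{O}_k$. An invariant design is a design of the form $\bar\xi=\sum_{k=L}^U\bar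 w_k\bar\xi_k$ with orbit weights $\bar w_k\ge 0$, $\sum_{k=L}^U\bar w_k=1$ (equivalently, a design invariant under permutations of the $K$ coordinates). For an invariant design, the moments are $m_1(\bar\xi)=\sum_{\bm{x}}\bar\xi(\bm{x})x_j$ (the same for every $j$) and $m_2(\bar\xi)=\sum_{\bm{x}}\bar\xi(\bm{x})x_jx_\ell$ (the same for every $j\ne\ell$). Explicitly, $m_1(\bar\xi)=\sum_{k=L}^U\bar w_k\frac{2k-K}{K}$ and, for $K\ge2$, $m_2(\bar\xi)=\sum_{k=L}^U\bar w_k\frac{(2k-K)^2-K}{K(K-1)}$. For $K=1$ there is no mixed moment and the condition $m_2(\bar\xi)=0$ is vacuous. *)

(* Defs.v *)
From mathcomp Require Import all_boot all_order all_algebra.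
From mathcomp Require Import reals.

Set Implicit Arguments.
Unset Strict Implicit.
Unset Printing Implicit Defensive.

Import Order.TTheory GRing.Theory Num.Theory.
Local Open Scope ring_scope.

(* A point of {-1,+1}^K is encoded by a boolean vector, true standing for +1;
   [lev R x j] is its j-th coordinate as an element of R. *)
Definition cube (K : nat) := {ffun 'I_K -> bool}.

Definition lev (R : realType) (K : nat) (x : cube K) (j : 'I_K) : R :=
  if x j then 1 else -1.

Definition npos (K : nat) (x : cube K) : nat := #|[set j | x j]|.

Lemma nposE (R : realType) (K : nat) (x : cube K) :
  (npos x)%:R = (K%:R + \sum_(j < K) lev R x j) / 2%:R.
Proof.
suff -> : K%:R + \sum_(j < K) lev R x j = (npos x)%:R * 2%:R.
  by rewrite mulfK // pnatr_eq0.
have -> : K%:R = \sum_(j < K) 1 :> R by rewrite sumr_const card_ord.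
rewrite -big_split /= /npos -sum1_card natr_sum mulr_suml.
rewrite [RHS]big_mkcond /=; apply: eq_bigr => j _.
by rewrite inE /lev; case: (x j); rewrite ?subrr // mul1r.
Qed.

Definition region (K L U : nat) : {set cube K} :=
  [set x | (L <= npos x <= U)%N].

Definition orbit (K L U k : nat) : {set cube K} :=
  [set x in region K L U | npos x == k].

(* A weight function on the region is represented by a function on the whole
   cube whose values outside the region are irrelevant: everything below only
   looks at its values on [region K L U]. *)
Definition is_design (R : realType) (K L U : nat) (xi : cube K -> R) : Prop :=
  (forall x, x \in region K L U -> 0 <= xi x) /\
  \sum_(x in region K L U) xi x = 1.

Definition regression (R : realType) (K : nat) (x : cube K) : 'cV[R]_(1 + K) :=
  col_mx (1%:M : 'cV[R]_1) (\col_(j < K) lev R x j).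

Definition info_mx (R : realType) (K L U : nat) (xi : cube K -> R) :
    'M[R]_(1 + K) :=
  \sum_(x in region K L U) xi x *: (regression R x *m (regression R x)^T).

Definition D_optimal (R : realType) (K L U : nat) (xi : cube K -> R) : Prop :=
  is_design L U xi /\
  forall eta : cube K -> R, is_design L U eta ->
    \det (info_mx L U eta) <= \det (info_mx L U xi).

Definition unif_orbit (R : realType) (K L U k : nat) (x : cube K) : R :=
  if x \in orbit K L U k then ('C(K, k)%:R)^-1 else 0.

Definition invariant_design (R : realType) (K L U : nat) (xi : cube K -> R) :
    Prop :=
  exists w : nat -> R,
    [/\ forall k, (L <= k <= U)%N -> 0 <= w k,
        \sum_(L <= k < U.+1) w k = 1
      & forall x, x \in region K L U ->
          xi x = \sum_(L <= k < U.+1) w k * unif_orbit R L U k x].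

(* For an invariant design these moments do not depend on the indices
   (j, resp. j <> l), so "m1 = m2 = 0" is the vanishing of all of them; when
   K = 1 there is no pair j <> l and the condition on m2 is vacuous. *)
Definition moment1 (R : realType) (K L U : nat) (xi : cube K -> R)
    (j : 'I_K) : R :=
  \sum_(x in region K L U) xi x * lev R x j.

Definition moment2 (R : realType) (K L U : nat) (xi : cube K -> R)
    (j l : 'I_K) : R :=
  \sum_(x in region K L U) xi x * lev R x j * lev R x l.

(* Main.v *)
Require Import Defs.
From mathcomp Require Import all_boot all_order all_algebra.
From mathcomp Require Import perm reals.
From mathcomp Require Import zify ring.

(** The regressors take the values 1 and -1, so the information matrix of every
    design is positive semidefinite with unit diagonal.  By Hadamard's
    inequality ([hadamard_inequality]) its determinant is at most 1, with
    equality only for the identity matrix, and the information matrix is the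
    identity exactly when all first and mixed second moments vanish
    ([info_mx_eq1]).  A design with vanishing moments is therefore D-optimal.

    Conversely, it suffices that the value 1 is attained by some design on the
    region, since every D-optimal design then has the identity as information
    matrix.  For an invariant design, with [y = 2 k - K] the sum of the
    coordinates on the orbit [k], the moments vanish as soon as [y] has mean 0
    and variance [K] under the orbit weights ([mixture_moment1_eq0],
    [mixture_moment2_eq0]).  Such weights exist ([exists_weights]): the
    mean-zero law on the two extreme values [- (K - 2 L)] and [2 U - K] has
    variance [(K - 2 L) (2 U - K)], which is at least [K] by hypothesis, whereas
    the uniform law on the central orbits has variance 0 or 1 according to the
    parity of [K], hence at most [K]; a mixture of the two laws has
    variance exactly [K]. *)

Set Implicit Arguments.
Unset Strict Implicit.

Import Order.TTheory GRing.Theory Num.Theory.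
Local Open Scope ring_scope.

(** * Hadamard's inequality *)

(** Symmetric positive semidefinite matrices; vectors are rows, so the
    quadratic form is [u A u^T]. *)
Definition psd (F : realFieldType) (n : nat) (A : 'M[F]_n) : Prop :=
  A^T = A /\ forall u : 'rV[F]_n, 0 <= (u *m A *m u^T) 0 0.

Lemma psd_diag_ge0 (F : realFieldType) (n : nat) (A : 'M[F]_n) (i : 'I_n) :
  psd A -> 0 <= A i i.
Proof.
move=> [_ /(_ (delta_mx 0 i))].
by rewrite -rowE trmx_delta -colE !mxE.
Qed.

(** A zero diagonal entry forces the whole row to vanish: otherwise the
    quadratic form is negative at a suitable vector of the plane spanned by the
    two coordinate vectors. *)
Lemma psd_row0 (F : realFieldType) (n : nat) (A : 'M[F]_n) (i j : 'I_n) :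
  psd A -> A i i = 0 -> A i j = 0.
Proof.
move=> [As Ap] Aii; apply/eqP; apply: contraT => Aij.
have sym : A j i = A i j by rewrite -[in LHS]As mxE.
(* The coefficient is chosen so that the quadratic form takes the value -1. *)
have := Ap (- ((A j j + 1) / (2 * A i j)) *: delta_mx 0 i + delta_mx 0 j).
rewrite linearD linearZ /= !trmx_delta !(mulmxDl, mulmxDr).
rewrite -!(scalemxAl, scalemxAr) -!rowE -!colE !mxE Aii sym.
set c := A i j in Aij *; set d := A j j.
rewrite !mulr0 add0r.
have -> : - ((d + 1) / (2 * c)) * c + (- ((d + 1) / (2 * c)) * c + d) = -1.
  by field.
by rewrite ler0N1.
Qed.

(** The Schur complement of the top left entry. *)
Definition schur (F : realFieldType) (n : nat) (A : 'M[F]_(1 + n)) : 'M[F]_n :=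
  drsubmx A - (A 0 0)^-1 *: (dlsubmx A *m ursubmx A).

Lemma schurE (F : realFieldType) (n : nat) (A : 'M[F]_(1 + n)) (i j : 'I_n) :
  schur A i j = A (rshift 1 i) (rshift 1 j) -
    (A 0 0)^-1 * (A (rshift 1 i) 0 * A 0 (rshift 1 j)).
Proof.
rewrite !mxE big_ord1 !mxE.
by rewrite (_ : lshift n 0 = 0) //; apply: val_inj.
Qed.

Lemma det_schur (F : realFieldType) (n : nat) (A : 'M[F]_(1 + n)) :
  A 0 0 != 0 -> \det A = A 0 0 * \det (schur A).
Proof.
move=> a0.
have E : A = block_mx 1%:M 0 ((A 0 0)^-1 *: dlsubmx A) 1%:M *m
             block_mx (ulsubmx A) (ursubmx A) 0 (schur A).
  have ulE : ulsubmx A = (A 0 0)%:M.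
    by rewrite [LHS]mx11_scalar !mxE (_ : lshift n 0 = 0) //; apply: val_inj.
  rewrite mulmx_block !mul1mx !mul0mx !addr0 -scalemxAl.
  rewrite ulE mul_mx_scalar scalerA mulVf // scale1r /schur -scalemxAl.
  by rewrite -ulE addrC subrK submxK.
rewrite [in LHS]E det_mulmx det_lblock det_ublock !det1 !mul1r.
by rewrite det_mx11 !mxE (_ : lshift n 0 = 0) //; apply: val_inj.
Qed.

Lemma psd_schur (F : realFieldType) (n : nat) (A : 'M[F]_(1 + n)) :
  0 < A 0 0 -> psd A -> psd (schur A).
Proof.
move=> a0 [As Ap]; split.
  have sym i j : A i j = A j i by rewrite -[in LHS]As mxE.
  apply/matrixP => i j; rewrite mxE !schurE (sym (rshift 1 j) (rshift 1 i)).
  by congr (_ - _ * _); rewrite (sym _ 0) (sym 0 (rshift 1 i)) mulrC.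
move=> u.
have lsh0 : lshift n 0 = 0 :> 'I_(1 + n) by apply: val_inj.
have ulE : ulsubmx A = (A 0 0)%:M.
  by rewrite [LHS]mx11_scalar !mxE lsh0.
rewrite /schur; set a := A 0 0 in a0 ulE *; set v := dlsubmx A.
(* The first coordinate minimises the quadratic form of [A] for the given [u];
   the minimum is the quadratic form of the Schur complement. *)
have := Ap (row_mx (- a^-1 *: (u *m v)) u).
rewrite -[in X in X -> _](submxK A) -/v tr_row_mx mul_row_block mul_row_col ulE.
rewrite mul_mx_scalar scalerA mulrN mulfV ?gt_eqF // scaleN1r addNr mul0mx.
rewrite add0r mulmxBr -scalemxAr -scalemxAl scaleNr mulmxA.
by rewrite addrC.
Qed.

(** Hadamard's inequality by induction on the size: passing to the Schur
    complement factors out the first diagonal entry and decreases the other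
    ones by multiples of the squares of the entries of the first row.  The
    equality case needs a positive diagonal: with a zero on the diagonal both
    sides vanish, even if the matrix is not diagonal. *)
Lemma hadamard_inequality (F : realFieldType) (n : nat) (A : 'M[F]_n) :
  psd A -> \det A <= \prod_i A i i /\
    ((forall i, 0 < A i i) -> \det A = \prod_i A i i -> is_diag_mx A).
Proof.
elim: n A => [|n IHn] A psdA.
  rewrite det_mx00 big_ord0; split=> // _ _.
  by apply/is_diag_mxP => -[].
have [As Ap] := psdA.
have sym i j : A i j = A j i by rewrite -[in LHS]As mxE.
rewrite big_ord_recl.
have := psd_diag_ge0 0 psdA; rewrite le_eqVlt => /orP[/eqP a0|a0].
  rewrite -a0 mul0r; split; last by move=> /(_ 0); rewrite -a0 ltxx.
  by rewrite (expand_det_row A 0) big1 // => j _; rewrite psd_row0 ?mul0r.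
have psdS := psd_schur (n := n) a0 psdA.
have [leS eqS] := IHn _ psdS.
rewrite (@det_schur _ n A) ?gt_eqF //.
pose B (i : 'I_n) : F := A (lift 0 i) (lift 0 i).
have SE (i j : 'I_n) :
    schur (n := n) A i j = A (lift 0 i) (lift 0 j) -
      (A 0 0)^-1 * (A 0 (lift 0 i) * A 0 (lift 0 j)).
  by rewrite schurE !rshift1 (sym (lift 0 i) 0).
have [leSB eqSB] : \prod_i schur (n := n) A i i <= \prod_i B i ?=
   iff (\prod_i B i == 0) || [forall (i | true), A 0 (lift 0 i) == 0].
  apply: leif_pprod => i _; first exact: psd_diag_ge0.
  rewrite SE -expr2 /B; apply/leifP; case: eqP => [->|/eqP h].
    by rewrite expr0n mulr0 subr0.
  by rewrite ltrBlDr ltrDl mulr_gt0 ?invr_gt0 // lt_def sqr_ge0 sqrf_eq0 h.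
split=> [|posA]; first by rewrite ler_pM2l // (le_trans leS).
move=> /(mulfI (lt0r_neq0 a0)) detE.
have posB : \prod_i B i != 0 by rewrite gt_eqF // prodr_gt0 // => i _; apply: posA.
have : \prod_i schur (n := n) A i i == \prod_i B i.
  by rewrite eq_le leSB /= -[X in X <= _]detE.
rewrite eqSB (negPf posB) /= => /forallP A0.
have {}A0 j : A 0 (lift 0 j) = 0 by apply/eqP/A0.
have SA i j : schur (n := n) A i j = A (lift 0 i) (lift 0 j).
  by rewrite SE A0 mul0r mulr0 subr0.
have /is_diag_mxP dS : is_diag_mx (schur (n := n) A).
  apply: eqS => [i|]; first by rewrite SA.
  by rewrite detE; apply: eq_bigr => i _; rewrite SA.
apply/is_diag_mxP => i j.
case: (unliftP 0 i) => [i'|] ->; case: (unliftP 0 j) => [j'|] ->.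
- by rewrite -SA => h; apply: dS; apply: contra_neq h => /val_inj ->.
- by rewrite sym A0.
- by rewrite A0.
- by rewrite eqxx.
Qed.

(** * Information matrices of designs *)

Lemma lev_sqr (R : realType) (K : nat) (x : cube K) (j : 'I_K) :
  lev R x j * lev R x j = 1.
Proof. by rewrite /lev; case: ifP => _; rewrite ?mulrNN mulr1. Qed.

Lemma regression0 (R : realType) (K : nat) (x : cube K) :
  regression R x (lshift K 0) 0 = 1.
Proof. by rewrite /regression col_mxEu mxE eqxx. Qed.

Lemma regressionS (R : realType) (K : nat) (x : cube K) (j : 'I_K) :
  regression R x (rshift 1 j) 0 = lev R x j.
Proof. by rewrite /regression col_mxEd mxE. Qed.

Lemma info_mxE (R : realType) (K L U : nat) (xi : cube K -> R) i j :
  info_mx L U xi i j =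
  \sum_(x in region K L U) xi x * (regression R x i 0 * regression R x j 0).
Proof.
rewrite /info_mx summxE; apply: eq_bigr => x _.
by rewrite mxE; congr (_ * _); rewrite mxE big_ord1 [X in _ * X]mxE.
Qed.

Lemma psd_info_mx (R : realType) (K L U : nat) (xi : cube K -> R) :
  is_design L U xi -> psd (info_mx L U xi).
Proof.
move=> [xi0 _]; split.
  apply/matrixP => i j; rewrite mxE !info_mxE.
  by apply: eq_bigr => x _; rewrite [X in _ * X]mulrC.
move=> u; rewrite /info_mx mulmx_sumr mulmx_suml summxE.
apply: sumr_ge0 => x xr; rewrite -scalemxAr -scalemxAl mxE mulr_ge0 ?xi0 //.
have -> : u *m (regression R x *m (regression R x)^T) *m u^T =
    (u *m regression R x) *m (u *m regression R x)^T by rewrite trmx_mul !mulmxA.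
by rewrite mxE big_ord1 [X in _ * X]mxE -expr2 sqr_ge0.
Qed.

Lemma info_mx_diag (R : realType) (K L U : nat) (xi : cube K -> R) i :
  is_design L U xi -> info_mx L U xi i i = 1.
Proof.
move=> [_ xi1]; rewrite info_mxE -[RHS]xi1; apply: eq_bigr => x _.
case: (split_ordP i) => [k ->|k ->].
  by rewrite (ord1 k) regression0 !mulr1.
by rewrite regressionS lev_sqr mulr1.
Qed.

Lemma info_mx_eq1 (R : realType) (K L U : nat) (xi : cube K -> R) :
  is_design L U xi ->
  info_mx L U xi = 1%:M <->
  (forall j : 'I_K, moment1 L U xi j = 0) /\
  (forall j l : 'I_K, j != l -> moment2 L U xi j l = 0).
Proof.
move=> dxi.
have E1 j : info_mx L U xi (lshift K 0) (rshift 1 j) = moment1 L U xi j.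
  rewrite info_mxE; apply: eq_bigr => x _.
  by rewrite regression0 regressionS mul1r.
have E1' j : info_mx L U xi (rshift 1 j) (lshift K 0) = moment1 L U xi j.
  rewrite info_mxE; apply: eq_bigr => x _.
  by rewrite regression0 regressionS mulr1.
have E2 j l : info_mx L U xi (rshift 1 j) (rshift 1 l) = moment2 L U xi j l.
  by rewrite info_mxE; apply: eq_bigr => x _; rewrite !regressionS mulrA.
split=> [I|[m1 m2]].
  split=> [j|j l jl]; first by rewrite -E1 I mxE eq_lrshift.
  by rewrite -E2 I mxE eq_rshift (negPf jl).
apply/matrixP => i j; rewrite [RHS]mxE.
have [<-|ij] := eqVneq i j; first exact: info_mx_diag.
case: (split_ordP i) (split_ordP j) ij => [k ->|k ->] [l ->|l ->].
- by rewrite !ord1 eqxx.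
- by rewrite ord1 E1 m1.
- by rewrite ord1 E1' m1.
- by rewrite eq_rshift E2 => /m2.
Qed.

Lemma det_info_mx_le1 (R : realType) (K L U : nat) (xi : cube K -> R) :
  is_design L U xi -> \det (info_mx L U xi) <= 1.
Proof.
move=> dxi; have [+ _] := hadamard_inequality (psd_info_mx dxi).
by rewrite big1 // => i _; rewrite info_mx_diag.
Qed.

Lemma det_info_mx_eq1 (R : realType) (K L U : nat) (xi : cube K -> R) :
  is_design L U xi -> \det (info_mx L U xi) = 1 -> info_mx L U xi = 1%:M.
Proof.
move=> dxi det1; have [_ eqH] := hadamard_inequality (psd_info_mx dxi).
have /is_diag_mxP dM : is_diag_mx (info_mx L U xi).
  apply: eqH => [i|]; first by rewrite info_mx_diag.
  by rewrite det1 big1 // => i _; rewrite info_mx_diag.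
apply/matrixP => i j; rewrite [RHS]mxE.
have [<-|ij] := eqVneq i j; first exact: info_mx_diag.
by rewrite dM.
Qed.

(** * Mixtures of uniform designs on orbits *)

Lemma card_orbit (K L U k : nat) :
  (L <= k <= U)%N -> #|Defs.orbit K L U k| = 'C(K, k).
Proof.
move=> kLU; have <- : #|[set A : {set 'I_K} | #|A| == k]| = 'C(K, k).
  by rewrite card_draws card_ord.
pose f (x : cube K) : {set 'I_K} := [set j | x j].
have f_inj : injective f.
  by move=> x y /setP exy; apply/ffunP => j; have := exy j; rewrite !inE.
rewrite -(card_imset _ f_inj); apply: eq_card => A; rewrite inE.
apply/imsetP/eqP => [[x]|cA].
  by rewrite inE => /andP[_ /eqP <-] ->.
have fA : f [ffun j => j \in A] = A by apply/setP => j; rewrite inE ffunE.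
by exists [ffun j => j \in A]; rewrite // !inE /npos -/(f _) fA cA kLU eqxx.
Qed.

(** The invariant design with orbit weights [w]. *)
Definition mixture (R : realType) (K L U : nat) (w : nat -> R) (x : cube K) : R :=
  \sum_(L <= k < U.+1) w k * unif_orbit R L U k x.

(** The expectation of a function of the number of entries equal to +1. *)
Lemma sum_mixture (R : realType) (K L U : nat) (w h : nat -> R) :
  (U <= K)%N ->
  \sum_(x in region K L U) mixture L U w x * h (npos x) =
  \sum_(L <= k < U.+1) w k * h k.
Proof.
move=> UK; rewrite /mixture; under eq_bigr do rewrite mulr_suml.
rewrite exchange_big /=; apply: eq_big_nat => k; rewrite ltnS => kLU.
have Ck : 'C(K, k)%:R != 0 :> R.
  by rewrite pnatr_eq0 -lt0n bin_gt0 (leq_trans _ UK) //; case/andP: kLU.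
transitivity (\sum_(x in Defs.orbit K L U k) w k * h k / 'C(K, k)%:R).
  rewrite [RHS]big_mkcond [LHS]big_mkcond /=; apply: eq_bigr => x _.
  rewrite /unif_orbit; case: ifPn => xr.
    rewrite inE xr /=; case: eqP => [->|_]; first by rewrite mulrAC.
    by rewrite mulr0 mul0r.
  by rewrite inE (negPf xr).
by rewrite sumr_const card_orbit // -[RHS](divfK Ck) mulr_natr.
Qed.

Lemma mixture_total (R : realType) (K L U : nat) (w : nat -> R) :
  (U <= K)%N ->
  \sum_(x in region K L U) mixture L U w x = \sum_(L <= k < U.+1) w k.
Proof.
move=> UK; have := @sum_mixture R K L U w (fun=> 1) UK.
under eq_bigr do rewrite mulr1.
by move=> ->; under eq_bigr do rewrite mulr1.
Qed.

Lemma mixture_is_design (R : realType) (K L U : nat) (w : nat -> R) :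
  (U <= K)%N -> (forall k, (L <= k <= U)%N -> 0 <= w k) ->
  \sum_(L <= k < U.+1) w k = 1 -> is_design L U (@mixture R K L U w).
Proof.
move=> UK w0 w1; split=> [x _|]; last by rewrite mixture_total.
rewrite /mixture big_nat; apply: sumr_ge0 => k; rewrite ltnS => kLU.
rewrite mulr_ge0 ?w0 // /unif_orbit; case: ifP => // _.
by rewrite invr_ge0.
Qed.

Lemma invariant_is_design (R : realType) (K L U : nat) (xi : cube K -> R) :
  (U <= K)%N -> invariant_design L U xi -> is_design L U xi.
Proof.
move=> UK [w [w0 w1 xiE]]; have [m0 m1] := mixture_is_design (K := K) UK w0 w1.
split=> [x xr|]; first by rewrite xiE // m0.
by rewrite -m1; apply: eq_bigr => x /xiE.
Qed.

(** * Moments of invariant designs *)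

(** The action of a permutation of the coordinates on the cube. *)
Definition permute (K : nat) (s : {perm 'I_K}) (x : cube K) : cube K :=
  [ffun j => x (s j)].

Lemma permute_inj (K : nat) (s : {perm 'I_K}) : injective (permute s).
Proof.
move=> x y /ffunP exy; apply/ffunP => j.
by have := exy (s^-1 j)%g; rewrite !ffunE permKV.
Qed.

Lemma lev_permute (R : realType) (K : nat) (s : {perm 'I_K}) (x : cube K) j :
  lev R (permute s x) j = lev R x (s j).
Proof. by rewrite /lev ffunE. Qed.

Lemma npos_permute (K : nat) (s : {perm 'I_K}) (x : cube K) :
  npos (permute s x) = npos x.
Proof.
rewrite /npos -(card_imset [set j | permute s x j] (@perm_inj _ s)).
apply: eq_card => j; rewrite inE; apply/imsetP/idP => [[i]|xj].
  by rewrite inE ffunE => xi ->.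
by exists (s^-1 j)%g; rewrite ?inE ?ffunE ?permKV.
Qed.

Lemma mixture_permute (R : realType) (K L U : nat) (w : nat -> R) s (x : cube K) :
  mixture L U w (permute s x) = mixture L U w x.
Proof.
by apply: eq_bigr => k _; rewrite /unif_orbit !inE npos_permute.
Qed.

Lemma sum_permute (R : realType) (K L U : nat) (s : {perm 'I_K})
    (F : cube K -> R) :
  \sum_(x in region K L U) F x = \sum_(x in region K L U) F (permute s x).
Proof.
rewrite (reindex_inj (@permute_inj K s)) /=.
by apply: eq_bigl => x; rewrite !inE npos_permute.
Qed.

Lemma moment1_permute (R : realType) (K L U : nat) (w : nat -> R)
    (s : {perm 'I_K}) (j : 'I_K) :
  moment1 L U (mixture L U w) (s j) = moment1 L U (mixture L U w) j.
Proof.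
rewrite /moment1 [RHS](sum_permute _ _ s); apply: eq_bigr => x _.
by rewrite mixture_permute lev_permute.
Qed.

Lemma moment2_permute (R : realType) (K L U : nat) (w : nat -> R)
    (s : {perm 'I_K}) (j l : 'I_K) :
  moment2 L U (mixture L U w) (s j) (s l) = moment2 L U (mixture L U w) j l.
Proof.
rewrite /moment2 [RHS](sum_permute _ _ s); apply: eq_bigr => x _.
by rewrite mixture_permute !lev_permute.
Qed.

Lemma sum_lev (R : realType) (K : nat) (x : cube K) :
  \sum_j lev R x j = 2 * (npos x)%:R - K%:R.
Proof. by rewrite nposE mulrC divfK ?pnatr_eq0 // addrC addKr. Qed.

(** The moments [moment1] do not depend on the index, and their sum is the mean
    of [2 k - K]. *)
Lemma mixture_moment1_eq0 (R : realType) (K L U : nat) (w : nat -> R) (j : 'I_K) :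
  (U <= K)%N ->
  \sum_(L <= k < U.+1) w k * (2 * k%:R - K%:R) = 0 ->
  moment1 L U (mixture L U w) j = 0.
Proof.
move=> UK; rewrite -(@sum_mixture R K _ _ w (fun k => 2 * k%:R - K%:R) UK).
under eq_bigr do rewrite -sum_lev mulr_sumr.
rewrite exchange_big /= (eq_bigr (fun=> moment1 L U (mixture L U w) j)) => [|i _].
  rewrite sumr_const card_ord => /eqP; rewrite mulrn_eq0 => /orP[/eqP K0|/eqP//].
  by have := ltn_ord j; rewrite [X in (_ < X)%N]K0.
by rewrite -(moment1_permute _ _ _ (tperm i j)) tpermR.
Qed.

(** The moments [moment2] at distinct indices are all equal.  The second moment
    of [2 k - K] is the sum of the [K] moments at equal indices, each equal to 1,
    and of the [K (K - 1)] others. *)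
Lemma mixture_moment2_eq0 (R : realType) (K L U : nat) (w : nat -> R)
    (j l : 'I_K) :
  (U <= K)%N -> j != l ->
  \sum_(L <= k < U.+1) w k = 1 ->
  \sum_(L <= k < U.+1) w k * (2 * k%:R - K%:R) ^+ 2 = K%:R ->
  moment2 L U (mixture L U w) j l = 0.
Proof.
move=> UK jl w1.
rewrite -(@sum_mixture R K _ _ w (fun k => (2 * k%:R - K%:R) ^+ 2) UK).
have m1 : \sum_(x in region K L U) mixture L U w x = 1.
  by rewrite mixture_total.
have m2 (a b : 'I_K) : a != b ->
    moment2 L U (mixture L U w) a b = moment2 L U (mixture L U w) j l.
  (* Two transpositions carry the pair [(j, l)] to [(a, b)]. *)
  move=> ab; rewrite -[RHS](moment2_permute _ _ _ (tperm j a)) tpermL.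
  have la : tperm j a l != a.
    by rewrite -[X in _ != X](tpermL j a) (inj_eq perm_inj) eq_sym.
  rewrite -[RHS](moment2_permute _ _ _ (tperm (tperm j a l) b)) tpermL.
  by rewrite (tpermD la) // eq_sym.
set M := moment2 _ _ _ j l in m2 *.
have -> : \sum_(x in region K L U)
     mixture L U w x * (2 * (npos x)%:R - K%:R) ^+ 2 =
   \sum_(a < K) \sum_(b < K) moment2 L U (mixture L U w) a b :> R.
  rewrite (eq_bigr (fun x => \sum_(a < K) \sum_(b < K)
    mixture L U w x * lev R x a * lev R x b)) => [|x _].
    rewrite exchange_big; apply: eq_bigr => a _.
    by rewrite exchange_big.
  rewrite -sum_lev expr2 mulrA mulr_sumr [RHS]exchange_big /=.
  by apply: eq_bigr => b _; rewrite mulr_sumr mulr_suml.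
rewrite (eq_bigr (fun=> 1 + M *+ K.-1)) => [|a _].
  rewrite sumr_const card_ord mulrnDl => /eqP.
  rewrite -subr_eq0 addrAC subrr add0r -mulrnA mulrn_eq0 => /orP[|/eqP//].
  by have := ltn_ord j; have := ltn_ord l; move: jl; rewrite -val_eqE /=; nia.
rewrite (bigD1 a) //=; congr (_ + _).
  rewrite -m1; apply: eq_bigr => x _.
  by rewrite -mulrA lev_sqr mulr1.
rewrite (eq_bigr (fun=> M)) => [|b ba]; last by rewrite m2 // eq_sym.
by rewrite sumr_const cardC1 card_ord.
Qed.

(** * Orbit weights with mean 0 and variance K *)

Lemma sum_dirac (R : realType) (L U p : nat) (h : nat -> R) :
  (L <= p <= U)%N -> \sum_(L <= k < U.+1) (k == p)%:R * h k = h p.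
Proof.
move=> pLU; rewrite (bigD1_seq p) ?iota_uniq ?mem_index_iota //=.
rewrite eqxx mul1r big1 ?addr0 // => k /negPf ->; exact: mul0r.
Qed.

Lemma exists_weights (R : realType) (K L U : nat) :
  (1 <= K)%N -> (L < U)%N ->
  K%:Z <= (K%:Z - 2 * L%:Z) * (2 * U%:Z - K%:Z) ->
  exists w : nat -> R,
    [/\ forall k, 0 <= w k,
        \sum_(L <= k < U.+1) w k = 1,
        \sum_(L <= k < U.+1) w k * (2 * k%:R - K%:R) = 0
      & \sum_(L <= k < U.+1) w k * (2 * k%:R - K%:R) ^+ 2 = K%:R].
Proof.
move=> K0 LU KLU.
have LK : (2 * L < K)%N by nia.
have KU : (K < 2 * U)%N by nia.
(* [- a] and [b] are the extreme values of [2 k - K], and [c], which is 0 or 1,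
   is the variance of the uniform law on the central orbits. *)
pose a : R := K%:R - 2 * L%:R; pose b : R := 2 * U%:R - K%:R.
pose c : R := (odd K)%:R.
have a0 : 0 < a by rewrite /a subr_gt0 -natrM ltr_nat.
have b0 : 0 < b by rewrite /b subr_gt0 -natrM ltr_nat.
have ab : K%:R <= a * b.
  by move: KLU; rewrite -(ler_int R) rmorphM !rmorphB !rmorphM.
have cK : c <= K%:R by rewrite ler_nat; case: odd.
have [t [t0 t1 tE]] : exists t : R,
    [/\ 0 <= t, t <= 1 & t * (a * b) + (1 - t) * c = K%:R].
  (* If [a * b = c], both variances are equal to [K] and any [t] is suitable. *)
  have [abc|abc] := eqVneq (a * b) c.
    exists 0; rewrite lexx ler01; split=> //.
    by rewrite mul0r add0r subr0 mul1r; apply/eqP; rewrite eq_le cK -abc ab.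
  have abc0 : 0 < a * b - c.
    by rewrite subr_gt0 lt_neqAle eq_sym abc (le_trans cK).
  exists ((K%:R - c) / (a * b - c)); split.
  - by rewrite divr_ge0 ?subr_ge0 // (le_trans cK).
  - by rewrite ler_pdivrMr // mul1r lerD2r.
  - by field; rewrite gt_eqF.
(* For [K] even [K./2] and [uphalf K] are equal and their weights add up. *)
pose r : R := (1 - t) / 2.
pose w (k : nat) : R :=
  t * b / (a + b) * (k == L)%:R + t * a / (a + b) * (k == U)%:R +
  r * (k == K./2)%:R + r * (k == uphalf K)%:R.
have sum_w (h : nat -> R) : \sum_(L <= k < U.+1) w k * h k =
  t * b / (a + b) * h L + t * a / (a + b) * h U +
  r * h K./2 + r * h (uphalf K).
  under eq_bigr do rewrite /w !mulrDl -!(mulrA _ _%:R).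
  by rewrite !big_split /= -!mulr_sumr !sum_dirac //; lia.
have sK : 2 * (K./2)%:R - K%:R = - c :> R.
  rewrite -[in X in _ - X](odd_double_half K) natrD -muln2 natrM /c; ring.
have sK' : 2 * (uphalf K)%:R - K%:R = c :> R.
  rewrite uphalf_half -[in X in _ - X](odd_double_half K) !natrD -muln2 natrM /c; ring.
have sL : 2 * L%:R - K%:R = - a :> R by rewrite /a opprB.
have ab0 : a + b != 0 by rewrite gt_eqF // addr_gt0.
have cc : c ^+ 2 = c by rewrite /c; case: odd; rewrite ?expr1n ?expr0n.
exists w; split.
- have r0 : 0 <= r by rewrite divr_ge0 ?subr_ge0.
  have p0 : 0 <= (a + b)^-1 by rewrite invr_ge0 addr_ge0 // ltW.
  by move=> k; rewrite /w !addr_ge0 ?(mulr_ge0 r0) ?mulr_ge0 ?(ltW a0) ?(ltW b0).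
- under eq_bigr do rewrite -[w _]mulr1.
  by rewrite (sum_w (fun=> 1)) /r; field; exact: ab0.
- rewrite (sum_w (fun k => 2 * k%:R - K%:R)) sK sK' sL -/b /r.
  by field; exact: ab0.
- rewrite (sum_w (fun k => (2 * k%:R - K%:R) ^+ 2)) sK sK' sL -/b !sqrrN cc -tE.
  by rewrite /r; field; exact: ab0.
Qed.

Theorem theorem2 (R : realType) (K L U : nat)
    (hK : (1 <= K)%N) (hLU : (L < U)%N) (hUK : (U <= K)%N)
    (hKLU : K%:Z <= (K%:Z - 2 * L%:Z) * (2 * U%:Z - K%:Z))
    (xi : cube K -> R) (hxi : invariant_design L U xi) :
  D_optimal L U xi <->
  (forall j : 'I_K, moment1 L U xi j = 0) /\
  (forall j l : 'I_K, j != l -> moment2 L U xi j l = 0).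
Proof.
have dxi := invariant_is_design hUK hxi.
split=> [[_ opt]|/(info_mx_eq1 dxi) I]; last first.
  by split=> // eta deta; rewrite I det1 det_info_mx_le1.
apply/(info_mx_eq1 dxi)/det_info_mx_eq1 => //.
have [w [w0 w1 w2 w3]] := @exists_weights R K L U hK hLU hKLU.
have dw : is_design L U (@mixture R K L U w) by exact: mixture_is_design.
have I : info_mx L U (@mixture R K L U w) = 1%:M.
  apply/(info_mx_eq1 dw); split=> [j|j l jl]; first exact: mixture_moment1_eq0.
  exact: mixture_moment2_eq0.
apply/eqP; rewrite eq_le det_info_mx_le1 //=.
by have := opt _ dw; rewrite I det1.
Qed.
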